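(* Let $\Pi$ be the equality-test conditional encryption construction described in the context, with message space $\Sigma^{\le n}$ and predicate $P_=$, where $P_=(m_1,m_2)=1$ if and only if $m_1=m_2$. Then $\Pi$ provides $(\infty,t_{\mathsf{Sim}},0)$-conditional encryption secrecy, where $t_{\mathsf{Sim}}$ is the time of doing one Paillier encryption.
   Context: **Conditional encryption.** For a binary predicate $P:\mathcal M\times\mathcal M\to\{0,1\}$, a conditional encryption scheme consists of algorithms $(\mathsf{KeyGen},\mathsf{Enc},\mathsf{CondEnc},\mathsf{Dec})$: $(sk,pk)=\mathsf{KeyGen}(1^\lambda;r)$; $\mathsf{Enc}_{pk}(m_1;r)$ outputs a ciphertext $(0,c)$ with flag $0$; $\mathsf{CondEnc}_{pk}((0,c),m_2,m_3;r)$ takes a regular ciphertext, a control message $m_2$ and a payload message $m_3$ and outputs a ciphertext $(1,\tilde c)$ with flag $1$ (and outputs $\bot$ if the input ciphertext has flag $1$); $\mathsf{Dec}_{sk}$ takes a flagged ciphertext and outputs a message in $\mathcal M$ or $\bot$. *Conditional encryption secrecy.* The scheme provides $(t(\cdot),t_{\mathsf{Sim}}(\cdot),\epsilon(\cdot))$-conditional encryption secrecy if there is a simulator $\mathsf{Sim}$ running in time at most $t_{\mathsf{Sim}}(\lambda)$ such that for all $m_1,m_2,m_3\in\mathcal M$ with $P(m_1,m_2)=0$, all $\lambda$, all coins $r,r_1$, and all distinguishers $\mathcal D$ running in time at most $t(\lambda)$, with $(sk,pk)=\mathsf{KeyGen}(1^\lambda;r)$ and $c_1=\mathsf{Enc}_{pk}(m_1;r_1)$,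 $$\big|\Pr[\mathcal D(sk,pk,m_1,m_2,m_3,c_1,\mathsf{Sim}(pk))=1]-\Pr[\mathcal D(sk,pk,m_1,m_2,m_3,c_1,\mathsf{CondEnc}_{pk}(c_1,m_2,m_3))=1]\big|\le\epsilon(t(\lambda),\lambda),$$ probabilities over the coins of $\mathcal D$, $\mathsf{Sim}$ and $\mathsf{CondEnc}$. With $t=\infty$ and $\epsilon=0$ this is perfect conditional encryption secrecy (unbounded distinguishers, zero advantage). **Paillier.** The public key is $(N,g)$ with $N=pq$, $p,q$ distinct primes, $\gcd(N,(p-1)(q-1))=1$, $g=N+1$. The secret key is $(\beta,\mu)$ with $\beta=\mathrm{lcm}(p-1,q-1)$, $\mu=(L(g^\beta \bmod N^2))^{-1}\bmod N$, $L(u)=(u-1)/N$. Encryption of $m\in\mathbb Z_N$ with nonce $r\in\mathbb Z_N^*$ is $g^m r^N \bmod N^2$; decryption of $c\in\mathbb Z_{N^2}^*$ is $L(c^\beta\bmod N^2)\cdot\mu\bmod N$. Write $\mathsf{P.Enc}$, $\mathsf{P.Dec}$ for these. **The equality-test construction.** $\Sigma$ is a finite alphabet, $\Sigma^{\le n}$ the set of strings of length at most $n$. $\mathsf{ToInt}:\Sigma^{\le n}\to\mathbb Z_{|\Sigma|^{n+1}}=\{0,\dots,|\Sigma|^{n+1}-1\}$ is a fixed injective map, and $\mathsf{ToInt}^{-1}(y)$ is the preimage of $y$, or $\bot$ if there is none. - $\mathsf{KeyGen}$: Paillier key generation, repeated until $|\Sigma|^{n+1}<\min\{p,q\}$ and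 $\gcd(N,(p-1)(q-1))=1$. - $\mathsf{Enc}_{pk}(m)=(0,\mathsf{P.Enc}_{pk}(\mathsf{ToInt}(m)))$ with fresh nonce. - $\mathsf{CondEnc}_{pk}((b,c),m_2,m_3)$: if $b=1$ or $\gcd(c,N)\ne1$ return $\bot$. Otherwise let $\hat m_2=\mathsf{ToInt}(m_2)$, $\hat m_3=\mathsf{ToInt}(m_3)$, pick uniform $R\in\mathbb Z_N$ and $r\in\mathbb Z_N^*$, and return $(1,c^=)$ with $c^= = c^R(N+1)^{-R\hat m_2+\hat m_3}r^N\bmod N^2$. - $\mathsf{Dec}_{sk}(b,c)=\mathsf{ToInt}^{-1}(\mathsf{P.Dec}_{sk}(c))$ for $b\in\{0,1\}$. *)

(* Defs.v *)
From HB Require Import structures.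
From mathcomp Require Import all_boot all_order all_algebra.
From mathcomp Require Import all_classical all_reals all_analysis.

Set Implicit Arguments.
Unset Strict Implicit.
Unset Printing Implicit Defensive.

Import Order.TTheory GRing.Theory Num.Theory.
Local Open Scope ring_scope.

(** * Randomised algorithms and their running time

    Algorithms are straight-line programs (arithmetic circuits) over natural
    numbers.  The registers initially hold the input; every instruction appends
    one register.

    The price of each arithmetic operation is a parameter and may depend on the
    values of its operands.  As in the notation Enc_pk(m; r), the random coins
    of an algorithm count as an input: drawing them is free. *)

Inductive opcode := OpAdd | OpSub | OpMul | OpDiv | OpMod | OpExpMod.

Definition eval_op (o : opcode) (x y z : nat) : nat :=
  match o with
  | OpAdd => x + y
  | OpSub => x - y
  | OpMul => x * y
  | OpDiv => x %/ y
  | OpMod => x %% y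
  | OpExpMod => (x ^ y) %% z
  end%N.

Definition cost_model := opcode -> nat -> nat -> nat -> nat.

Inductive operand := Reg of nat | Imm of nat.

Definition eval_operand (s : seq nat) (a : operand) : nat :=
  match a with Reg i => nth 0%N s i | Imm k => k end.

(** [Residues] draws uniformly from Z_k, [Units] from Z_k^*. *)
Inductive sampler := Residues | Units.

Definition sampler_support (d : sampler) (k : nat) : seq nat :=
  match d with
  | Residues => iota 0 k
  | Units => [seq x <- iota 0 k | coprime x k]
  end.

Inductive instr :=
  | Op of opcode & operand & operand & operand
  | Draw of sampler & operand.

Record program := Program { body : seq instr; output : seq operand }.

Definition step (s : seq nat) (o : opcode) (a b c : operand) : seq nat :=
  rcons s (eval_op o (eval_operand s a) (eval_operand s b) (eval_operand s c)).

Fixpoint body_time (cost : cost_model) (p : seq instr) (s : seq nat) : nat :=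
  match p with
  | [::] => 0
  | Op o a b c :: p' =>
      cost o (eval_operand s a) (eval_operand s b) (eval_operand s c)
      + body_time cost p' (step s o a b c)
  | Draw d a :: p' =>
      \max_(x <- sampler_support d (eval_operand s a))
         body_time cost p' (rcons s x)
  end%N.

(** Running time on a given input, in the worst case over the coins. *)
Definition time (cost : cost_model) (p : program) (input : seq nat) : nat :=
  body_time cost (body p) input.

Section Expectation.
Variable R : realType.

Fixpoint body_expect (p : seq instr) (s : seq nat) (f : seq nat -> R) : R :=
  match p with
  | [::] => f s
  | Op o a b c :: p' => body_expect p' (step s o a b c) f
  | Draw d a :: p' =>
      let D := sampler_support d (eval_operand s a) in
      (\sum_(x <- D) body_expect p' (rcons s x) f) / (size D)%:R
  end.

(** Expectation of [f (p(input))] over the coins of [p]. *)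
Definition expect (p : program) (input : seq nat) (f : seq nat -> R) : R :=
  body_expect (body p) input (fun s => f (map (eval_operand s) (output p))).

(** Expectation of [f] under the uniform distribution on [T]. *)
Definition uniform_expect (T : finType) (f : T -> R) : R :=
  (\sum_(w : T) f w) / #|T|%:R.

End Expectation.

(** * Conditional encryption *)

(** A ciphertext is a flag (0 is [false], 1 is [true]) and a body.  In
    [option ciphertext], [None] is the symbol bot. *)
Definition ciphertext := (bool * nat)%type.

Definition encode_ciphertext (c : option ciphertext) : seq nat :=
  if c is Some (b, x) then [:: nat_of_bool b; x] else [::].

Definition decode_ciphertext (s : seq nat) : option ciphertext :=
  if s is [:: b; x] then Some (b == 1%N, x) else None.

(** Coins of [Enc] and [CondEnc] are uniform on a finite set that may depend on
    the public key.  [KeyGen] returns [None] on coins on which it diverges.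
    The fields [code_pk], [code_sk], [code_msg] present keys and messages to
    algorithms; [body_space pk] is the space of ciphertext bodies under [pk]. *)
Record cond_enc_scheme (M : Type) := CondEncScheme {
  pk_type : Type;
  sk_type : Type;
  code_pk : pk_type -> seq nat;
  code_sk : sk_type -> seq nat;
  code_msg : M -> seq nat;
  body_space : pk_type -> pred nat;
  KeyGen_coins : nat -> Type;
  KeyGen : forall lam : nat, KeyGen_coins lam -> option (sk_type * pk_type);
  Enc_coins : pk_type -> finType;
  Enc : forall pk, M -> Enc_coins pk -> ciphertext;
  CondEnc_coins : pk_type -> finType;
  CondEnc : forall pk, ciphertext -> M -> M -> CondEnc_coins pk ->
    option ciphertext;
  Dec : pk_type -> sk_type -> ciphertext -> option M
}.

Section Secrecy.
Variables (R : realType) (cost : cost_model) (M : Type).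
Variable Pi : cond_enc_scheme M.

Record dist_input := DistInput {
  in_sk : sk_type Pi;
  in_pk : pk_type Pi;
  in_m1 : M;
  in_m2 : M;
  in_m3 : M;
  in_c1 : ciphertext;
  in_c : option ciphertext
}.

Definition code_dist_input (x : dist_input) : seq nat :=
  code_pk (in_pk x) ++ code_sk (in_sk x) ++
  code_msg Pi (in_m1 x) ++ code_msg Pi (in_m2 x) ++ code_msg Pi (in_m3 x) ++
  encode_ciphertext (Some (in_c1 x)) ++ encode_ciphertext (in_c x).

Definition level_input (lam : nat) (x : dist_input) : Prop :=
  [/\ exists r : KeyGen_coins Pi lam, KeyGen r = Some (in_sk x, in_pk x),
      body_space (in_pk x) (in_c1 x).2
    & if in_c x is Some c then body_space (in_pk x) c.2 else true].

(** A randomised map to bits: on input [x], the output bit is distributed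
    according to [D x]. *)
Definition distinguisher := dist_input -> probability bool R.

(** Under a finite bound a distinguisher has to be computed by a program within
    the bound; under the bound +oo it is an arbitrary randomised map. *)
Definition runs_within (T : \bar R) (lam : nat) (D : distinguisher) : Prop :=
  T = +oo%E \/
  exists p : program, forall x, level_input lam x ->
    ((time cost p (code_dist_input x))%:R%:E <= T)%E /\
    (expect p (code_dist_input x) (fun o => (o == [:: 1%N])%:R))%:E
      = D x [set true]%classic.

Definition accept (D : distinguisher) (x : dist_input) : R :=
  fine (D x [set true]%classic).

Definition cond_enc_secrecy (P : M -> M -> bool)
    (t : nat -> \bar R) (tSim : nat -> nat) (eps : \bar R -> nat -> R) : Prop :=
  exists Sim : program,
    (forall (lam : nat) (r : KeyGen_coins Pi lam) sk pk,
       KeyGen r = Some (sk, pk) ->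
       (time cost Sim (code_pk pk) <= tSim lam)%N) /\
    (forall (m1 m2 m3 : M), P m1 m2 = false ->
     forall (lam : nat) (r : KeyGen_coins Pi lam) sk pk,
       KeyGen r = Some (sk, pk) ->
     forall (r1 : Enc_coins pk) (D : distinguisher),
       runs_within (t lam) lam D ->
       let c1 := Enc m1 r1 in
       let game c := accept D (DistInput sk pk m1 m2 m3 c1 c) in
       `| expect Sim (code_pk pk) (fun o => game (decode_ciphertext o))
          - uniform_expect
              (fun w : CondEnc_coins pk => game (CondEnc c1 m2 m3 w)) |
       <= eps (t lam) lam).

End Secrecy.

(** * Paillier encryption *)

Definition paillier_pk := (nat * nat)%type. (* (N, g) *)
Definition paillier_sk := (nat * nat)%type. (* (beta, mu) *)

Definition paillier_L (N u : nat) : nat := ((u - 1) %/ N)%N.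

Definition paillier_keys (p q : nat) : paillier_sk * paillier_pk :=
  let N := (p * q)%N in
  let g := N.+1 in
  let beta := lcmn p.-1 q.-1 in
  let mu : 'Z_N := ((paillier_L N ((g ^ beta) %% N ^ 2)%N)%:R)^-1 in
  ((beta, nat_of_ord mu), (N, g)).

Definition paillier_nonce (N : nat) := {r : 'I_N | coprime r N}.

Definition P_Enc (pk : paillier_pk) (m r : nat) : nat :=
  ((pk.2 ^ m * r ^ pk.1) %% pk.1 ^ 2)%N.

Definition P_Dec (pk : paillier_pk) (sk : paillier_sk) (c : nat) : nat :=
  ((paillier_L pk.1 ((c ^ sk.1) %% pk.1 ^ 2) * sk.2) %% pk.1)%N.

(** Paillier encryption as an algorithm on input N, g, m. *)
Definition paillier_program : program :=
  Program
    [:: Draw Units (Reg 0);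
        Op OpMul (Reg 0) (Reg 0) (Imm 0);
        Op OpExpMod (Reg 1) (Reg 2) (Reg 4);
        Op OpExpMod (Reg 3) (Reg 0) (Reg 4);
        Op OpMul (Reg 5) (Reg 6) (Imm 0);
        Op OpMod (Reg 7) (Reg 4) (Imm 0)]
    [:: Reg 8].

Lemma paillier_programE (R : realType) (pk : paillier_pk) (m : nat)
    (f : seq nat -> R) :
  expect paillier_program [:: pk.1; pk.2; m] f =
  uniform_expect (fun r : paillier_nonce pk.1 =>
    f [:: P_Enc pk m (val r : 'I_pk.1)]).
Proof.
case: pk => N g; rewrite /expect /uniform_expect /=.
set F := fun r : nat => f [:: P_Enc (N, g) m r].
rewrite (eq_bigr F); last first.
  by move=> r _; rewrite /F /P_Enc /= modnMml modnMmr mulnn.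
have -> : \sum_(i <- [seq x <- iota 0 N | coprime x N]) F i =
          \sum_(w : paillier_nonce N) F (val w : 'I_N).
  rewrite big_filter -{1}[N]subn0 -/(index_iota 0 N) big_mkord.
  rewrite (reindex_omap (val : paillier_nonce N -> 'I_N) insub).
    by apply: eq_bigl => w; rewrite valK eqxx andbT (valP w).
  by move=> i iN; rewrite insubT.
congr (_ / _%:R).
rewrite card_sig -sum1_size big_filter -{1}[N]subn0 -/(index_iota 0 N).
by rewrite big_mkord sum1_card.
Qed.

(** * The equality-test construction *)

(** Prime generation at security level lam; [gen_primes] is one attempt, and key
    generation repeats it with fresh coins. *)
Record prime_generator := PrimeGenerator {
  gen_coins : nat -> finType;
  gen_primes : forall lam : nat, gen_coins lam -> nat * nat;
  gen_primesP : forall (lam : nat) (w : gen_coins lam),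
    [/\ prime (gen_primes w).1, prime (gen_primes w).2
      & (gen_primes w).1 != (gen_primes w).2]
}.

Section EqualityTest.
Variables (Sigma : finType) (n : nat).
Variable ToInt : n.-bseq Sigma -> 'I_(#|Sigma| ^ n.+1).
Variable gen : prime_generator.

Definition accepted_primes (pq : nat * nat) : bool :=
  ((#|Sigma| ^ n.+1 < minn pq.1 pq.2) &&
   coprime (pq.1 * pq.2) ((pq.1 - 1) * (pq.2 - 1)))%N.

(** The coins are those of all the attempts; the first accepted attempt is
    used. *)
Definition eq_KeyGen (lam : nat) (r : nat -> gen_coins gen lam) :
    option (paillier_sk * paillier_pk) :=
  match pselect (exists i, accepted_primes (gen_primes (r i))) with
  | left h =>
      let pq := gen_primes (r (ex_minn h)) in Some (paillier_keys pq.1 pq.2)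
  | right _ => None
  end.

Definition eq_Enc (pk : paillier_pk) (m : n.-bseq Sigma)
    (r : paillier_nonce pk.1) : ciphertext :=
  (false, P_Enc pk (ToInt m) (val r : 'I_pk.1)).

(** The exponent of N + 1 is an integer, possibly negative: it is taken in the
    ring Z_{N^2}, where N + 1 is a unit. *)
Definition eq_CondEnc (pk : paillier_pk) (c1 : ciphertext)
    (m2 m3 : n.-bseq Sigma) (w : 'I_pk.1 * paillier_nonce pk.1) :
    option ciphertext :=
  let: (b, c) := c1 in
  let N := pk.1 in
  let Rnd : nat := w.1 in
  let r : nat := (val w.2 : 'I_N) in
  if b || (gcdn c N != 1%N) then None else
  let ceq : 'Z_(N ^ 2) :=
    c%:R ^+ Rnd
    * N.+1%:R ^ (- (Rnd%:Z * (ToInt m2)%:Z) + (ToInt m3)%:Z)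
    * r%:R ^+ N in
  Some (true, nat_of_ord ceq).

Definition eq_Dec (pk : paillier_pk) (sk : paillier_sk) (bc : ciphertext) :
    option (n.-bseq Sigma) :=
  [pick m | nat_of_ord (ToInt m) == P_Dec pk sk bc.2].

Definition eq_scheme : cond_enc_scheme (n.-bseq Sigma) :=
  {| pk_type := paillier_pk;
     sk_type := paillier_sk;
     code_pk := fun pk => [:: pk.1; pk.2];
     code_sk := fun sk => [:: sk.1; sk.2];
     code_msg := fun m => [:: nat_of_ord (ToInt m)];
     body_space := fun pk c => (c < pk.1 ^ 2)%N;
     KeyGen_coins := fun lam => nat -> gen_coins gen lam;
     KeyGen := eq_KeyGen;
     Enc_coins := fun pk => paillier_nonce pk.1;
     Enc := eq_Enc;
     CondEnc_coins := fun pk => ('I_pk.1 * paillier_nonce pk.1)%type;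
     CondEnc := eq_CondEnc;
     Dec := eq_Dec |}.

Definition eq_predicate (m1 m2 : n.-bseq Sigma) : bool := m1 == m2.

(** Time of one Paillier encryption at level lam: the worst case over the keys
    that key generation can output, the plaintext and the nonce. *)
Definition paillier_time (cost : cost_model) (lam : nat) : nat :=
  \max_(w : gen_coins gen lam | accepted_primes (gen_primes w))
    let pk := (paillier_keys (gen_primes w).1 (gen_primes w).2).2 in
    \max_(m < pk.1) time cost paillier_program [:: pk.1; pk.2; nat_of_ord m].

End EqualityTest.

(* Main.v *)
Require Import Defs.
From HB Require Import structures.
From mathcomp Require Import all_boot all_order all_algebra.
From mathcomp Require Import all_classical all_reals all_analysis.

(** The simulator encrypts a uniform element of Z_N.  If the control message
    differs from the encrypted one, then m1 - m2 is a unit mod N, since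
    |m1 - m2| < min(p, q), and the conditional ciphertext is a Paillier
    encryption of R (m1 - m2) + m3 with nonce r1^R r.  The map
    (R, r) |-> (R (m1 - m2) + m3, r1^R r) is a bijection of Z_N x Z_N^*, so the
    conditional ciphertext is distributed exactly as the simulated one. *)

Set Implicit Arguments.
Unset Strict Implicit.
Unset Printing Implicit Defensive.

Import Order.TTheory GRing.Theory Num.Theory.
Local Open Scope ring_scope.

(** In a^N - b^N = (a - b) * sum_i a^(N-1-i) b^i the sum has N terms, all congruent to b^(N-1) mod
    N, so both factors are divisible by N. *)
Lemma eqn_mod_expn_sqr (N a b : nat) :
  (a = b %[mod N] -> a ^ N = b ^ N %[mod N ^ 2])%N.
Proof.
have [->|N0] := posnP N; first by rewrite !modn0 => ->.
wlog ba : a b / (b <= a)%N.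
  by move=> W; case/orP: (leq_total a b) => h e; [apply/esym|]; apply: W.
move=> e; apply/eqP; rewrite eqn_mod_dvd ?leq_exp2r//.
rewrite subn_exp -mulnn dvdn_mul//; first by rewrite -eqn_mod_dvd//; apply/eqP.
rewrite /dvdn -modn_summ (eq_bigr (fun=> b ^ N.-1 %% N)%N) => [|i _].
  by rewrite sum_nat_const card_ord modnMr.
rewrite -modnMm -modnXm e modnXm modnMm -expnD subnK//.
by rewrite -ltnS prednK.
Qed.

(** N-th powers mod N^2 depend only on the base mod N. This handles the nonce directly, and the
    plaintext because N + 1 = 1 mod N gives (N + 1)^N = 1 mod N^2. *)
Lemma P_Enc_mod (N m s : nat) :
  P_Enc (N, N.+1) (m %% N) (s %% N) = P_Enc (N, N.+1) m s.
Proof.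
rewrite /P_Enc /= -modnMmr (eqn_mod_expn_sqr (modn_mod s N)) modnMmr.
rewrite [in RHS](divn_eq m N) expnD [in RHS]expnM -mulnA -[in RHS]modnMml.
rewrite (@eqn_mod_expn_sqr N _ 1); first by rewrite exp1n modnMml mul1n.
by rewrite -modnXm -addn1 modnDl modnXm exp1n.
Qed.

Lemma coprime_P_Enc (N m s : nat) :
  (0 < N)%N -> coprime s N -> coprime (P_Enc (N, N.+1) m s) N.
Proof.
move=> N0 cs; rewrite /P_Enc/= -coprime_modl modn_dvdm -?mulnn ?dvdn_mulr//.
by rewrite coprime_modl coprimeMl !coprimeXl// coprimeSn.
Qed.

(** [a + (p * q - b)] represents a - b mod pq without negative numbers. If p or q divided it, a and
    b would agree modulo that prime; both lie below it, so they would be equal. *)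
Lemma coprime_distinct_residues (p q a b : nat) :
  prime p -> prime q -> (a < minn p q)%N -> (b < minn p q)%N -> a != b ->
  coprime (p * q) (a + (p * q - b)).
Proof.
move=> pp pq; rewrite !leq_min => /andP[ap aq] /andP[bp bq] ab.
have bpq : (b <= p * q)%N.
  by rewrite (leq_trans (ltnW bp))// leq_pmulr// prime_gt0.
suff H r : (r %| p * q)%N -> (a < r)%N -> (b < r)%N ->
    ~~ (r %| a + (p * q - b))%N.
  by rewrite coprimeMl !prime_coprime// !H//; [exact: dvdn_mull|exact: dvdn_mulr].
move=> rpq ar br; apply: contra ab => h.
have : (a + p * q == b %[mod r])%N.
  by rewrite eqn_mod_dvd -?addnBA// (leq_trans bpq)// leq_addl.
by rewrite -modnDmr (eqP rpq) addn0 !modn_small.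
Qed.

(** Adding R * N to the exponent changes nothing as g^N = 1, and turns the integer exponent into a
    natural number. *)
Lemma exprz_order (A : unitRingType) (g : A) (N R a b : nat) :
  g \is a GRing.unit -> g ^+ N = 1 -> (b <= N)%N ->
  g ^ (- (R%:Z * b%:Z) + a%:Z) = g ^+ (R * (N - b) + a).
Proof.
move=> ug gN bN; rewrite -[RHS]/(g ^ (R * (N - b) + a)%N%:Z).
rewrite PoszD PoszM -subzn// mulrBr -addrA [RHS]exprzDr//.
by rewrite [R%:Z * N%:Z]mulrC -exprz_exp [g ^ N%:Z]gN exp1rz mul1r.
Qed.

(** Paillier is homomorphic: the power [w.1] multiplies the plaintext and exponentiates the nonce,
    and the other factors add to the plaintext and multiply the nonce. Both results are reduced mod
    N to match the values of [mask]. *)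
Lemma eq_CondEncE (Sigma : finType) (n : nat)
    (ToInt : n.-bseq Sigma -> 'I_(#|Sigma| ^ n.+1)) (N : nat)
    (m1 m2 m3 : n.-bseq Sigma) (r1 : paillier_nonce N)
    (w : 'I_N * paillier_nonce N) :
  (1 < N)%N -> (ToInt m2 <= N)%N ->
  eq_CondEnc (pk := (N, N.+1)) ToInt
    (eq_Enc (pk := (N, N.+1)) ToInt m1 r1) m2 m3 w =
  Some (true, P_Enc (N, N.+1)
    ((w.1 * (ToInt m1 + (N - ToInt m2)) + ToInt m3) %% N)%N
    (((val r1 : 'I_N) ^ w.1 * (val w.2 : 'I_N)) %% N)%N).
Proof.
move=> N1 m2N; have N0 := ltnW N1.
(* The type ['Z_k] is the ring of integers mod k only for k > 1. *)
have NN1 : (1 < N ^ 2)%N by rewrite -{1}(exp1n 2) ltn_exp2r.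
have gN : (N.+1%:R : 'Z_(N ^ 2)) ^+ N = 1.
  rewrite -natrX -Zp_nat_mod// (@eqn_mod_expn_sqr N _ 1) ?exp1n ?Zp_nat_mod//.
  by rewrite -addn1 modnDl.
have gu : (N.+1%:R : 'Z_(N ^ 2)) \is a GRing.unit.
  by apply/unitrPr; exists (N.+1%:R ^+ N.-1); rewrite -exprS prednK.
rewrite P_Enc_mod /eq_CondEnc /eq_Enc orFb.
(* An honest ciphertext is prime to N, so the gcd test passes. *)
rewrite (eqP (coprime_P_Enc _ N0 (valP r1))) eqxx; congr (Some (_, _)).
case: w => x s; rewrite /fst/snd.
rewrite (exprz_order _ _ gu gN)// /P_Enc/fst/snd Zp_nat_mod//.
rewrite -!(natrX, natrM) val_Zp_nat//; congr (_ %% _)%N.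
rewrite !expnMn -!expnM mulnDr !expnD.
rewrite (mulnC x N) (mulnC x (ToInt m1)) !mulnA.
by rewrite -!(mulnAC _ ((val r1 : 'I_N) ^ _)%N).
Qed.

Lemma coprime_eqn_modM2r (N d x y : nat) :
  coprime N d -> (x * d == y * d %[mod N])%N = (x == y %[mod N])%N.
Proof.
move=> cd; wlog yx : x y / (y <= x)%N.
  move=> W; case/orP: (leq_total y x) => h; first exact: W.
  by rewrite eq_sym [RHS]eq_sym; apply: W.
by rewrite !eqn_mod_dvd ?leq_mul// -mulnBl Gauss_dvdl.
Qed.

Lemma modn_inj_ord (N : nat) (x y : 'I_N) : x = y %[mod N] -> x = y.
Proof. by rewrite !modn_small// => /val_inj. Qed.

Section Mask.
Variables (N d a : nat) (s : paillier_nonce N).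

Let N_gt0 (x : 'I_N) : (0 < N)%N := leq_ltn_trans (leq0n x) (ltn_ord x).

Let mask_nonce (k : nat) (r : paillier_nonce N) : 'I_N :=
  Ordinal (ltn_pmod ((val s : 'I_N) ^ k * (val r : 'I_N)) (N_gt0 (val r))).

Fact mask_nonce_subproof (k : nat) (r : paillier_nonce N) :
  coprime (mask_nonce k r) N.
Proof. by rewrite coprime_modl coprimeMl coprimeXl ?(valP s) ?(valP r). Qed.

(** Sends the coins of [CondEnc] to the plaintext and nonce of its output: [s] is the nonce of the
    first ciphertext, [d] represents m1 - m2 and [a] is the payload. *)
Definition mask (w : 'I_N * paillier_nonce N) : 'I_N * paillier_nonce N :=
  (Ordinal (ltn_pmod (w.1 * d + a) (N_gt0 w.1)),
   Sub (mask_nonce w.1 w.2) (mask_nonce_subproof w.1 w.2)).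

(** On a finite set injectivity suffices. The first components determine the residue since d is a
    unit mod N; the common power of s, also a unit, then cancels from the second. *)
Lemma mask_bij : coprime N d -> bijective mask.
Proof.
move=> cd; apply: injF_bij => -[x r] [y t] [/eqP + /eqP].
rewrite eqn_modDr coprime_eqn_modM2r// => /eqP/modn_inj_ord ->.
rewrite !(mulnC (_ ^ _)%N) coprime_eqn_modM2r.
  by move=> /eqP/modn_inj_ord/val_inj ->.
by rewrite coprimeXr// coprime_sym (valP s).
Qed.

End Mask.

Lemma eq_KeyGenP (Sigma : finType) (n : nat) (gen : prime_generator)
    (lam : nat) (r : nat -> gen_coins gen lam) sk pk :
  eq_KeyGen Sigma n r = Some (sk, pk) ->
  exists2 w : gen_coins gen lam, accepted_primes Sigma n (gen_primes w)
    & (sk, pk) = paillier_keys (gen_primes w).1 (gen_primes w).2.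
Proof.
rewrite /eq_KeyGen; case: pselect => // h [<- <-].
by case: ex_minnP => i ri _; exists (r i).
Qed.

(** On input N, g, the drawn residue lands in register 2, where
    [paillier_program] expects its plaintext; its body is reused unchanged. *)
Definition paillier_simulator : program :=
  Program (Draw Residues (Reg 0) :: body paillier_program) [:: Imm 1; Reg 8].

Lemma paillier_simulatorE (R : realType) (N g : nat) (f : seq nat -> R) :
  expect paillier_simulator [:: N; g] f =
  uniform_expect (fun w : 'I_N * paillier_nonce N =>
    f [:: 1%N; P_Enc (N, g) w.1 (val w.2 : 'I_N)]).
Proof.
rewrite -[LHS]/((\sum_(m <- iota 0 N)
  expect paillier_program [:: N; g; m] (fun o => f (1%N :: o)))
    / (size (iota 0 N))%:R).
under eq_bigr do rewrite (paillier_programE (N, g)).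
rewrite size_iota -mulr_suml -[X in iota 0 X]subn0 -/(index_iota 0 N) big_mkord.
by rewrite pair_bigA /uniform_expect card_prod card_ord natrM invfM mulrA mulrAC.
Qed.

Theorem theorem2 (R : realType) (Sigma : finType) (n : nat)
    (ToInt : n.-bseq Sigma -> 'I_(#|Sigma| ^ n.+1))
    (ToInt_inj : injective ToInt)
    (gen : prime_generator) (cost : cost_model) :
  @cond_enc_secrecy R cost (n.-bseq Sigma) (@eq_scheme Sigma n ToInt gen)
    (@eq_predicate Sigma n)
    (fun _ : nat => +oo%E)
    (@paillier_time Sigma n gen cost)
    (fun (_ : \bar R) (_ : nat) => 0%R).
Proof.
exists paillier_simulator; split.
  move=> lam r sk pk /eq_KeyGenP[w acc [_ ->]].
  (* Draws are free, so the worst case over the drawn residue is the maximum over plaintexts in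
     [paillier_time]. *)
  apply: leq_trans (leq_bigmax_cond w acc).
  rewrite -[leqLHS]/(\max_(m <- iota 0 ((gen_primes w).1 * (gen_primes w).2)) _)%N.
  by rewrite -[X in iota 0 X]subn0 -/(index_iota 0 _) big_mkord.
move=> m1 m2 m3 /negbT m12 lam r sk pk /eq_KeyGenP[w acc [_ ->]] r1 D _.
have [pp pq _] := gen_primesP w; have /andP[bound _] := acc.
set p := (gen_primes w).1 in pp bound r1 *.
set q := (gen_primes w).2 in pq bound r1 *.
have lt_minn m : (ToInt m < minn p q)%N by apply: ltn_trans bound.
have le_pq : (minn p q <= p * q)%N.
  by rewrite (leq_trans (geq_minl _ _))// leq_pmulr// prime_gt0.
have pq1 : (1 < p * q)%N.
  by rewrite (leq_trans _ le_pq)// leq_min !prime_gt1.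
cbv zeta; rewrite normr_le0 subr_eq0; apply/eqP.
rewrite -[code_pk _]/[:: (p * q)%N; (p * q).+1] paillier_simulatorE.
(* Both averages run over Z_N x Z_N^*, so only the sums have to agree. *)
congr (_ / _).
pose d := (ToInt m1 + (p * q - ToInt m2))%N.
have cd : coprime (p * q) d.
  apply: coprime_distinct_residues => //.
  by rewrite (inj_eq val_inj) (inj_eq ToInt_inj).
(* Reindexing the simulator's sum along [mask] makes the two sums equal term by term, for any
   [D]. *)
rewrite (reindex _ (onW_bij _ (mask_bij (ToInt m3) r1 cd))); apply: eq_bigr => v _.
congr (accept _ (DistInput _ _ _ _ _ _ _)); apply/esym/eq_CondEncE => //.
exact: leq_trans (ltnW (lt_minn m2)) le_pq.
Qed.
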